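(* Let $m,n$ be positive integers, $T>0$, $\alpha>0$, and let $A$ be the $m\times n$ heat-kernel matrix whose entry in row $j$ and column $i$ is $g\left(\frac in-\frac jm\right)$, where $g(x)=\frac{1}{\sqrt{4\pi T}}e^{-x^2/(4T)}$. Let $\triangle_2(A)$ be the $\ell_2$ sensitivity of $f_0\mapsto Af_0$ with respect to $\alpha$-neighbours, i.e. the supremum of $\|Af_0-Af_0'\|_2$ over all source vectors $f_0,f_0'\in[0,1]^n$ with $\mathrm{EMD}(f_0,f_0')\le\alpha$. Then $$\triangle_2(A)=O\left(\frac{\alpha\sqrt m}{T^{1.5}}\right),$$ where the implied constant is absolute.
   Context: Source locations are the points $\frac1n,\frac2n,\dots,1$ with metric $d\left(\frac in,\frac jn\right)=\left|\frac in-\frac jn\right|$; sensors are at $\frac1m,\dots,1$. A source vector is a vector in $[0,1]^n$ whose $i$th entry is the source strength at $\frac in$; it is regarded as a probability distribution on the locations (entries sum to $1$). Earth Mover Distance: for probability vectors $p,q\in[0,1]^n$, $\mathrm{EMD}(p,q)$ is the minimum of $\sum_{i,j}\mathfrak{f}_{ij}\left|\frac in-\frac jn\right|$ over all $\mathfrak{f}\in[0,1]^{n\times n}$ with $\sum_j\mathfrak{f}_{ij}\le p_i$ for all $i$, $\sum_i\mathfrak{f}_{ij}\le q_j$ for all $j$, and $\sum_{i,j}\mathfrak{f}_{ij}=1$. Source vectors are $\alpha$-neighbours if their EMD is at most $\alpha$. *)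

(* Defs.v *)
From HB Require Import structures.
From mathcomp Require Import all_boot all_order all_algebra.
From mathcomp Require Import all_classical all_reals all_analysis.
Set Implicit Arguments.
Unset Strict Implicit.
Unset Printing Implicit Defensive.
Import Order.TTheory GRing.Theory Num.Theory.
Import numFieldNormedType.Exports.
Local Open Scope classical_set_scope.
Local Open Scope ring_scope.

Section Defs.
Context {R : realType}.

(* Ordinals start at 0, so the index k : 'I_n stands for the point (k + 1) / n:
   the locations are 1/n, 2/n, ..., 1. *)
Definition location n (k : 'I_n) : R := k.+1%:R / n%:R.

Definition source_vector n : set 'cV[R]_n :=
  [set p | (forall i, 0 <= p i 0 <= 1) /\ \sum_i p i 0 = 1].

Definition flow n (p q : 'cV[R]_n) : set 'M[R]_n :=
  [set f | [/\ forall i j, 0 <= f i j <= 1,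
               forall i, \sum_j f i j <= p i 0,
               forall j, \sum_i f i j <= q j 0
             & \sum_i \sum_j f i j = 1]].

Definition flow_cost n (f : 'M[R]_n) : R :=
  \sum_i \sum_j f i j * `|location i - location j|.

(* On source vectors this infimum is a minimum: see emd_min. *)
Definition emd n (p q : 'cV[R]_n) : R := inf (flow_cost (n := n) @` flow p q).

Definition neighbours n (alpha : R) (p q : 'cV[R]_n) : Prop :=
  [/\ source_vector p, source_vector q & emd p q <= alpha].

Definition l2norm m (v : 'cV[R]_m) : R := Num.sqrt (\sum_j v j 0 ^+ 2).

(* Taken in the extended reals, so that an unbounded set of values has
   supremum +oo (the supremum in R would be 0 by convention). *)
Definition l2_sensitivity m n (alpha : R) (F : 'cV[R]_n -> 'cV[R]_m) : \bar R :=
  ereal_sup [set (l2norm (F pq.1 - F pq.2))%:E |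
             pq in [set pq | neighbours alpha pq.1 pq.2]].

Definition heat_kernel (T x : R) : R :=
  (Num.sqrt (4 * pi * T))^-1 * expR (- (x ^+ 2) / (4 * T)).

Definition heat_matrix m n (T : R) : 'M[R]_(m, n) :=
  \matrix_(j < m, i < n) heat_kernel T (location i - location j).

Lemma product_flow n (p q : 'cV[R]_n) : source_vector p -> source_vector q ->
  flow p q (p *m q^T).
Proof.
move=> [p01 p1] [q01 q1].
have E i j : (p *m q^T) i j = p i 0 * q j 0 by rewrite !mxE big_ord1 mxE.
have Er i : \sum_j (p *m q^T) i j = p i 0.
  by under eq_bigr do rewrite E; rewrite -mulr_sumr q1 mulr1.
split=> [i j|i|j|].
- have /andP[p0 ple] := p01 i; have /andP[q0 qle] := q01 j.
  by rewrite E mulr_ge0//= mulr_ile1.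
- by rewrite Er.
- by under eq_bigr do rewrite E; rewrite -mulr_suml p1 mul1r.
- by under eq_bigr do rewrite Er.
Qed.

Lemma emd_min n (p q : 'cV[R]_n) : source_vector p -> source_vector q ->
  exists2 f, flow p q f & flow_cost f = emd p q /\
    forall f', flow p q f' -> flow_cost f <= flow_cost f'.
Proof.
move=> sp sq.
have coef i j : continuous (fun v : 'rV[R]_(n * n) => (vec_mx v : 'M[R]_n) i j).
  have -> : (fun v : 'rV[R]_(n * n) => (vec_mx v : 'M[R]_n) i j) =
      (fun v : 'rV[R]_(n * n) => v 0 (mxvec_index i j)).
    by apply/funext => v; rewrite mxE.
  exact: coord_continuous.
have csum (c : 'I_n -> 'rV[R]_(n * n) -> R) :
    (forall i, continuous (c i)) -> continuous (fun v => \sum_i c i v).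
  move=> cc; apply: (@continuous_big _ _ +%R 0 xpredT) => [|i _].
    exact: add_continuous.
  exact: cc.
pose A := [set v : 'rV[R]_(n * n) | flow p q (vec_mx v)].
have cA : compact A.
  have cK : compact [set v : 'rV[R]_(n * n) | forall k, v ord0 k \in `[0, 1]].
    apply: (@rV_compact _ _ (fun=> `[(0 : R), 1]%classic)) => _.
    exact: segment_compact.
  apply: subclosed_compact cK _.
  - pose pre (B : set R) (g : 'rV[R]_(n * n) -> R) := g @^-1` B.
    have pcl B g : closed B -> continuous g -> closed (pre B g).
      by move=> Bc gc; apply: preimage_closed => // x _; exact: gc.
    rewrite (_ : A = \bigcap_(ij in @setT ('I_n * 'I_n))
               pre (`[0, 1]%classic) (fun v => vec_mx v ij.1 ij.2) `&`
             \bigcap_(i in @setT 'I_n)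
               pre [set x | x <= p i 0] (fun v => \sum_j vec_mx v i j) `&`
             \bigcap_(j in @setT 'I_n)
               pre [set x | x <= q j 0] (fun v => \sum_i vec_mx v i j) `&`
             pre [set x | x = 1] (fun v => \sum_i \sum_j vec_mx v i j)).
      apply: closedI; first apply: closedI; first apply: closedI.
      + apply: closed_bigI => -[i j] _; apply: (pcl); last exact: coef.
        exact: interval_closed.
      + apply: closed_bigI => i _; apply: (pcl); first exact: closed_le.
        by apply: (csum) => j; exact: coef.
      + apply: closed_bigI => j _; apply: (pcl); first exact: closed_le.
        by apply: (csum) => i; exact: coef.
      + apply: (pcl); first exact: closed_eq.
        by apply: (csum) => i; apply: (csum) => j; exact: coef.
    apply/seteqP; split=> v.
      case=> v01 vp vq v1; split=> //; split; first split.
      + by move=> [i j] _ /=; rewrite /pre /= in_itv; exact: v01.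
      + by move=> i _; exact: vp.
      + by move=> j _; exact: vq.
    case=> -[[v01 vp] vq] v1; split=> [i j|i|j|].
    + by have := v01 (i, j) I; rewrite /pre /= in_itv.
    + exact: vp.
    + exact: vq.
    + exact: v1.
  - move=> v [v01 _ _ _] k; case/mxvec_indexP: k => i j.
    by have := v01 i j; rewrite mxE /= in_itv.
have A0 : A !=set0.
  by exists (mxvec (p *m q^T)); rewrite /A /= mxvecK; exact: product_flow.
have [|v vA vmin] := EVT_min_rV (f := fun v => flow_cost (vec_mx v)) A0 cA.
  apply: continuous_subspaceT => v.
  apply: (csum) => i; apply: (csum) => j {}v.
  apply: (@cvgMr_tmp _ _ (nbhs v) _ (fun v => vec_mx v i j)).
  exact: (coef i j v).
rewrite inE in vA.
have lb f' : flow p q f' -> flow_cost (vec_mx v) <= flow_cost f'.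
  by move=> ff'; have := vmin (mxvec f'); rewrite inE /A /= mxvecK; exact.
exists (vec_mx v) => //; split=> //.
apply/eqP; rewrite eq_le; apply/andP; split.
  apply: lb_le_inf; first by exists (flow_cost (vec_mx v)), (vec_mx v).
  by move=> _ [f' ff' <-]; exact: lb.
apply: ge_inf; last by exists (vec_mx v).
by exists (flow_cost (vec_mx v)) => _ [f' ff' <-]; exact: lb.
Qed.

End Defs.

(* Main.v *)
(* An optimal flow between probability vectors p and q has marginals exactly p
   and q, so A (p - q) is the sum of the columns' differences weighted by the
   flow.  The points lie in [0, 1], so the kernel is only evaluated on [-1, 1],
   where it is T^(-3/2)-Lipschitz: e^x is 1-Lipschitz for x <= 0 and
   |x^2 - y^2| <= 2 |x - y|.  Hence each of the m entries of A (p - q) is at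
   most alpha T^(-3/2). *)
Require Import Defs.
From mathcomp Require Import all_boot all_order all_algebra.
From mathcomp Require Import all_classical all_reals all_analysis.
From mathcomp Require Import ring lra.
Import Order.TTheory GRing.Theory Num.Theory.
Local Open Scope ring_scope.

(** The differences [G i - F i] are nonnegative and sum to zero, so each of them vanishes. *)
Lemma eq_ler_sum (R : numDomainType) (I : finType) (F G : I -> R) :
  (forall i, F i <= G i) -> \sum_i F i = \sum_i G i -> forall i, F i = G i.
Proof.
move=> FG eFG i; apply/esym/eqP; rewrite -subr_eq0.
have /psumr_eq0P : forall k, true -> 0 <= G k - F k.
  by move=> k _; rewrite subr_ge0.
by move=> -> //; rewrite sumrB eFG subrr.
Qed.

Section HeatKernelSensitivity.
Context {R : realType}.

Lemma expR_le0_lipschitz (x y : R) : x <= 0 -> y <= 0 ->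
  `|expR x - expR y| <= `|x - y|.
Proof.
wlog xy : x y / x <= y.
  move=> H x0 y0; have [xy|/ltW yx] := leP x y; first exact: H.
  by rewrite distrC (distrC x); exact: H.
move=> x0 y0; rewrite distrC (distrC x) !ger0_norm ?subr_ge0 ?ler_expR//.
(* The factor [expR y] is at most 1 because [y <= 0]; the other is at most [y - x] by
   [1 + t <= expR t] at [t = x - y]. *)
have -> : expR y - expR x = expR y * (1 - expR (x - y)).
  by rewrite mulrBr mulr1 -expRD [y + _]addrC subrK.
have e1 : 1 - expR (x - y) <= y - x by have := expR_ge1Dx (x - y); lra.
apply: le_trans e1; rewrite ler_piMl ?expR_le1//.
by rewrite subr_ge0 expR_le1 subr_le0.
Qed.

Lemma powR3half (T : R) : 0 < T -> T `^ (3 / 2) = T * Num.sqrt T.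
Proof.
move=> T0; have -> : 3 / 2 = 1 + 2^-1 :> R by lra.
by rewrite powRD ?gt_eqF ?implybT// powRr1 ?powR12_sqrt// ltW.
Qed.

Lemma heat_kernel_lipschitz (T x y : R) : 0 < T -> `|x| <= 1 -> `|y| <= 1 ->
  `|heat_kernel T x - heat_kernel T y| <= (T `^ (3 / 2))^-1 * `|x - y|.
Proof.
move=> T0 x1 y1; have T4 : 0 < 4 * T by lra.
have neg z : - z ^+ 2 / (4 * T) <= 0.
  by rewrite mulNr oppr_le0 divr_ge0 ?sqr_ge0// ltW.
have lip : `|expR (- x ^+ 2 / (4 * T)) - expR (- y ^+ 2 / (4 * T))| <=
    T^-1 * `|x - y|.
  apply: le_trans (expR_le0_lipschitz _ _ (neg x) (neg y)) _.
  (* Difference of squares; on [-1, 1] the factor [(x + y) / 4] is at most 1/2 in absolute value. *)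
  have -> : - x ^+ 2 / (4 * T) - - y ^+ 2 / (4 * T) =
      T^-1 * ((y - x) * ((x + y) / 4)).
    by field; rewrite gt_eqF.
  rewrite normrM gtr0_norm ?invr_gt0// ler_pM2l ?invr_gt0//.
  rewrite normrM distrC ler_piMr// normrM (gtr0_norm (_ : 0 < 4^-1))//.
  by have := ler_normD x y; lra.
(* The constant is dropped using [4 * pi >= 1]. *)
have sqrtT : `|(Num.sqrt (4 * pi * T))^-1| <= (Num.sqrt T)^-1.
  rewrite ger0_norm ?invr_ge0 ?sqrtr_ge0// lef_pV2 ?posrE ?sqrtr_gt0//.
    by apply: ler_wsqrtr; have := pi_ge2 R; nra.
  by rewrite !mulr_gt0 ?pi_gt0.
rewrite /heat_kernel -mulrBr normrM powR3half// [in leRHS]invfM [leRHS]mulrAC [leLHS]mulrC.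
exact: ler_pM.
Qed.

Lemma location_itv01 n (k : 'I_n) : 0 <= (location k : R) <= 1.
Proof.
have n0 : (0 < n)%N by apply: leq_ltn_trans (ltn_ord k).
rewrite /location divr_ge0//= ler_pdivrMr ?ltr0n// mul1r ler_nat.
exact: ltn_ord.
Qed.

(** The row sums of [f] and the entries of [p] have the same total 1, so no row inequality can be
    strict; likewise for columns and [q]. *)
Lemma flow_marginals n (p q : 'cV[R]_n) f :
  source_vector p -> source_vector q -> flow p q f ->
  (forall i, \sum_j f i j = p i 0) /\ (forall j, \sum_i f i j = q j 0).
Proof.
move=> [_ p1] [_ q1] [_ fp fq f1]; split; apply: eq_ler_sum => //.
- by rewrite f1.
- by rewrite exchange_big f1.
Qed.

(** The easy direction of Kantorovich duality: moving mass [f i k] from [i] to [k] changes the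
    integral of [h] by at most [L] times the cost of the move. *)
Lemma flow_sum_lipschitz n (p q : 'cV[R]_n) f (h : 'I_n -> R) (L : R) :
  source_vector p -> source_vector q -> flow p q f ->
  (forall i k, `|h i - h k| <= L * `|location i - location k|) ->
  `|\sum_i h i * (p i 0 - q i 0)| <= L * flow_cost f.
Proof.
move=> sp sq ff hL; have [fp fq] := flow_marginals _ _ _ _ sp sq ff.
have [f01 _ _ _] := ff.
have -> : \sum_i h i * (p i 0 - q i 0) =
    \sum_i \sum_k f i k * (h i - h k).
  under [RHS]eq_bigr do under eq_bigr do rewrite mulrBr.
  under [RHS]eq_bigr do rewrite sumrB -mulr_suml fp.
  rewrite sumrB exchange_big /= -sumrB; apply: eq_bigr => i _.
  by rewrite -mulr_suml fq mulrBr ![h i * _]mulrC.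
rewrite /flow_cost mulr_sumr; apply: le_trans (ler_norm_sum _ _ _) _.
apply: ler_sum => i _; rewrite mulr_sumr.
apply: le_trans (ler_norm_sum _ _ _) _; apply: ler_sum => k _.
have /andP[f0 _] := f01 i k.
by rewrite normrM ger0_norm// mulrCA ler_wpM2l.
Qed.

Lemma l2norm_le m (v : 'cV[R]_m) (B : R) : 0 <= B ->
  (forall j, `|v j 0| <= B) -> l2norm v <= B * Num.sqrt m%:R.
Proof.
move=> B0 vB; rewrite -{1}(ger0_norm B0) -sqrtr_sqr -sqrtrM ?sqr_ge0//.
apply: ler_wsqrtr; rewrite mulr_natr -[m in leRHS]card_ord -sumr_const.
by apply: ler_sum => j _; rewrite -(real_normK (num_real (v j 0))) lerXn2r ?nnegrE.
Qed.

End HeatKernelSensitivity.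

Theorem proposition13 (R : realType) :
  exists2 C : R, 0 < C &
    forall (m n : nat) (T alpha : R),
      (0 < m)%N -> (0 < n)%N -> 0 < T -> 0 < alpha ->
      (l2_sensitivity alpha (fun f0 : 'cV[R]_n => heat_matrix m n T *m f0)
         <= (C * (alpha * Num.sqrt m%:R / T `^ (3 / 2)))%:E)%E.
Proof.
(* The constant 1 suffices, since the kernel bound already absorbs [4 * pi]. *)
exists 1 => // m n T alpha _ _ T0 alpha0.
apply: ge_ereal_sup => _ [[p q] /= [sp sq pq] <-]; rewrite lee_fin mul1r.
have [f ff [fE _]] := emd_min sp sq.
set L := (T `^ (3 / 2))^-1.
have L0 : 0 <= L by rewrite invr_ge0 powR_ge0.
rewrite mulrC mulrA; apply: l2norm_le; first by rewrite mulr_ge0// ltW.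
move=> j; rewrite -mulmxBr mxE.
under eq_bigr do rewrite !mxE.
(* Row [j] of the matrix serves as the test function [h]; the optimal [f] has cost [emd p q], at
   most [alpha]. *)
apply: (@le_trans _ _ (L * flow_cost f)); last by rewrite ler_wpM2l// fE.
apply: (flow_sum_lipschitz _ _ _ _ _ _ sp sq ff) => i k.
have dist1 (l : 'I_n) : `|location l - location j : R| <= 1.
  have /andP[? ?] := @location_itv01 R _ l.
  by have /andP[? ?] := @location_itv01 R _ j; rewrite ler_norml; lra.
apply: le_trans (heat_kernel_lipschitz _ _ _ T0 (dist1 i) (dist1 k)) _.
(* The sensor location cancels in the difference of the two kernel arguments. *)
by rewrite opprB addrA subrK.
Qed.
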